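(* Let $[E_k^n]$, $n=1,2,\ldots$, and $[E_k^\infty]$ be ends of $\Omega$. Then the following are equivalent: (a) The sequence of ends $\{[E_k^n]\}_{n=1}^\infty$ converges to the end $[E_k^\infty]$, and $[E_k^\infty]$ is a singleton end. (b) Whenever $\{x_i^n\}_{i=1}^\infty$, $n=1,2,\ldots$, and $\{x_i^\infty\}_{i=1}^\infty$ are sequences in $\Omega$ which converge to $[E_k^n]$ and $[E_k^\infty]$, respectively, as $i\to\infty$, we must have $$\lim_{n\to\infty}\limsup_{i\to\infty}d_M(x_i^n,x_i^\infty)=0.$$
   Context: Setting: $(X,d,\mu)$ is a metric measure space with more than one point, $\mu$ is a Borel measure with $0<\mu(B)<\infty$ for all balls $B$, and $1\le p<\infty$ is fixed. $X$ is complete, $\mu$ is doubling (there is $C_\mu>0$ with $\mu(B(x,2r))\le C_\mu\mu(B(x,r))$ for all balls), and $X$ supports a $p$-Poincaré inequality: there are $C_{PI}>0$, $\lambda\ge1$ such that for all balls $B$ and all $u\in N^{1,p}(X)$, $\frac{1}{\mu(B)}\int_B|u-u_B|\,d\mu\le C_{PI}\operatorname{diam}(B)\bigl(\frac{1}{\mu(\lambda B)}\int_{\lambda B}g_u^p\,d\mu\bigr)^{1/p}$, where $u_B=\frac{1}{\mu(B)}\int_B u\,d\mu$. Here a nonnegative Borel function $g$ is an upper gradient of $u:X\to[-\infty,\infty]$ if for every nonconstant rectifiable curve $\gamma:[0,l_\gamma]\to X$ parameterized by arc length, $|u(\gamma(0))-u(\gamma(l_\gamma))|\le\int_\gamma g\,ds$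 when both values are finite, and $\int_\gamma g\,ds=\infty$ otherwise; $N^{1,p}(X)$ is the space of measurable $u$ with $\int_X|u|^p\,d\mu+\inf_g\int_X g^p\,d\mu<\infty$ (infimum over upper gradients $g$ of $u$), and $g_u$ is the minimal $p$-weak upper gradient of $u$ (the a.e.-smallest $L^p$ function satisfying the upper gradient inequality for all curves except a family $\Gamma$ for which some nonnegative Borel $\rho\in L^p(X)$ has $\int_\gamma\rho\,ds=\infty$ for all $\gamma\in\Gamma$). $\Omega\subsetneq X$ is a bounded domain (bounded nonempty connected open set); closures and boundaries of subsets of $\Omega$ are taken in $X$. Ends: A bounded connected set $E\subsetneq\Omega$ is acceptable if $\overline E\cap\partial\Omega\ne\varnothing$. A sequence $\{E_k\}_{k=1}^\infty$ of acceptable sets is a chain if (i) $E_{k+1}\subset E_k$ for all $k$; (ii) $\operatorname{dist}(\Omega\cap\partial E_{k+1},\Omega\cap\partial E_k)>0$ for all $k$; (iii) the impression $\bigcap_{k=1}^\infty\overline{E}_k$ is contained in $\partial\Omega$. A chain $\{E_k\}$ divides a chain $\{F_k\}$ if for each $k$ there is $l$ with $E_l\subset F_k$. Two chains are equivalent if they divide each other; an end $[E_k]$ is an equivalence class of chains, and its impression $I[E_k]$ is the impression of any representative chain. A singleton end is an end whose impression is a single point. Convergence (independent of representative chains): a sequence of points $\{x_n\}$ in $\Omega$ converges to the end $[E_k]$ if for all $k$ there is $n_k$ with $x_n\in E_k$ whenever $n\ge n_k$. A sequence of ends $\{[E_k^n]\}_{n=1}^\infty$ converges to the end $[E_k^\infty]$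 if for every $k$ there is $n_k$ such that for each $n\ge n_k$ there is $l_{n,k}$ with $E^n_{l_{n,k}}\subset E_k^\infty$. Mazurkiewicz distance: for $x,y\in\Omega$, $d_M(x,y)=\inf\operatorname{diam}E$, the infimum over all connected sets $E\subset\Omega$ containing $x$ and $y$. *)

(* Defs.v *)
From HB Require Import structures.
From mathcomp Require Import all_boot all_order all_algebra.
From mathcomp Require Import all_classical all_reals all_analysis.
From mathcomp Require Import measurable_realfun.

Set Implicit Arguments.
Unset Strict Implicit.
Unset Printing Implicit Defensive.

Import Order.TTheory GRing.Theory Num.Theory.
Import numFieldNormedType.Exports.

Local Open Scope classical_set_scope.
Local Open Scope ring_scope.

(* [Complete] carries a distinguished point; this costs nothing for the nonempty
   spaces considered here, and is needed by [g_sigma_algebraType]. *)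
#[short(type="completeMetricType")]
HB.structure Definition CompleteMetric (R : numDomainType) :=
  { T of Metric R T & Complete T }.

Notation borelType X := (g_sigma_algebraType (@open X)).

Section MetricNotions.
Context {R : realType} {X : metricType R}.
Implicit Types (A B : set X) (gamma : R -> X).
Local Open Scope ereal_scope.

Definition diam A : \bar R :=
  ereal_sup [set (mdist x y)%:E | x in A & y in A].

(* The distance to the empty set is +oo. *)
Definition set_dist A B : \bar R :=
  ereal_inf [set (mdist x y)%:E | x in A & y in B].

Definition boundary A : set X := closure A `\` A°.

Definition curve_length gamma (a b : R) : \bar R :=
  ereal_sup [set (\sum_(0 <= i < size s)
    mdist (gamma (nth b (a :: s) i)) (gamma (nth b (a :: s) i.+1)))%R%:E
    | s in itv_partition a b].

(* Nonconstant rectifiable curves [0, l] -> X parameterized by arc length; the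
   values of gamma outside [0, l] are irrelevant.  Such a curve has length l,
   so that it is nonconstant exactly when 0 < l. *)
Definition arc_length_curve (l : R) gamma : Prop :=
  [/\ (0 < l)%R,
      {within `[0%R, l], continuous gamma} &
      forall s t : R, (0 <= s)%R -> (s <= t)%R -> (t <= l)%R ->
        curve_length gamma s t = (t - s)%:E].

End MetricNotions.

Section Sobolev.
Context {R : realType} {X : completeMetricType R}.
Variable mu : {measure set (borelType X) -> \bar R}.
Variable p : R.
Implicit Types (u g h rho : borelType X -> \bar R).
Local Open Scope ereal_scope.

Definition doubling : Prop :=
  exists2 C : R, (0 < C)%R &
    forall (x : X) (r : R), (0 < r)%R ->
      mu (ball x (2 * r)%R) <= C%:E * mu (ball x r).

Definition nonneg_borel g : Prop :=
  (forall x, 0 <= g x) /\ measurable_fun setT g.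

Definition curve_integral g (l : R) (gamma : R -> X) : \bar R :=
  \int[lebesgue_measure]_(t in `[0%R, l]) g (gamma t).

Definition gradient_inequality u g (l : R) (gamma : R -> X) : Prop :=
  let finite_ends := (u (gamma 0%R) \is a fin_num) && (u (gamma l) \is a fin_num) in
  (finite_ends ->
    `|u (gamma 0%R) - u (gamma l)| <= curve_integral g l gamma) /\
  (~~ finite_ends -> curve_integral g l gamma = +oo).

Definition upper_gradient u g : Prop :=
  nonneg_borel g /\
  forall l gamma, arc_length_curve l gamma -> gradient_inequality u g l gamma.

Definition exceptional_family (Gamma : R -> (R -> X) -> Prop) : Prop :=
  exists rho, [/\ nonneg_borel rho,
    \int[mu]_x (rho x `^ p) < +oo &
    forall l gamma, arc_length_curve l gamma -> Gamma l gamma ->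
      curve_integral rho l gamma = +oo].

Definition weak_upper_gradient u g : Prop :=
  nonneg_borel g /\
  exists2 Gamma, exceptional_family Gamma &
    forall l gamma, arc_length_curve l gamma -> ~ Gamma l gamma ->
      gradient_inequality u g l gamma.

Definition minimal_weak_upper_gradient u g : Prop :=
  [/\ weak_upper_gradient u g,
      \int[mu]_x (g x `^ p) < +oo &
      forall h, weak_upper_gradient u h -> \int[mu]_x (h x `^ p) < +oo ->
        {ae mu, forall x, g x <= h x}].

Definition newtonian u : Prop :=
  measurable_fun setT u /\
  \int[mu]_x (`|u x| `^ p) +
    ereal_inf [set \int[mu]_x (g x `^ p) | g in upper_gradient u] < +oo.

(* Used for sets of finite positive measure only. *)
Definition average (B : set X) u : \bar R :=
  (fine (mu B))^-1%:E * \int[mu]_(x in B) u x.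

(* The minimal weak upper gradient of u exists and is unique up to null sets, so
   the inequality does not depend on its choice. *)
Definition poincare : Prop :=
  exists CPI lambda : R, [/\ (0 < CPI)%R, (1 <= lambda)%R &
    forall u, newtonian u ->
      exists2 g, minimal_weak_upper_gradient u g &
        forall (x : X) (r : R), (0 < r)%R ->
          average (ball x r) (fun y => `|u y - average (ball x r) u|) <=
          CPI%:E * diam (ball x r) *
            (average (ball x (lambda * r)%R) (fun y => g y `^ p)) `^ p^-1].

End Sobolev.

Section Ends.
Context {R : realType} {X : metricType R}.
Variable Omega : set X.
Implicit Types (E F : nat -> set X) (A : set X).
Local Open Scope ereal_scope.

Definition bounded_domain : Prop :=
  [/\ diam Omega < +oo, Omega !=set0, connected Omega & open Omega].

Definition acceptable A : Prop :=
  [/\ diam A < +oo, connected A, A `<` Omega &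
      closure A `&` boundary Omega !=set0].

Definition chain_impression E : set X := \bigcap_k closure (E k).

Definition chain E : Prop :=
  [/\ forall k, acceptable (E k),
      forall k, E k.+1 `<=` E k,
      forall k, 0 < set_dist (Omega `&` boundary (E k.+1))
                             (Omega `&` boundary (E k)) &
      chain_impression E `<=` boundary Omega].

Definition divides E F : Prop := forall k, exists l, E l `<=` F k.

Definition chain_equiv E F : Prop := divides E F /\ divides F E.

Record domain_end := DomainEnd {
  end_chains :> (nat -> set X) -> Prop;
  end_chainsP : exists2 E, chain E &
    end_chains = [set F | chain F /\ chain_equiv E F] }.

Implicit Types (e : domain_end).

(* The notions below do not depend on the representatives: see the lemmas
   [singleton_endP], [points_convergeP] and [ends_convergeP]. *)
Definition singleton_end e : Prop :=
  exists2 E, e E & exists x, chain_impression E = [set x].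

Definition points_converge_chain (x : nat -> X) E : Prop :=
  forall k, exists N, forall n, (N <= n)%N -> E k (x n).

Definition points_converge (x : nat -> X) e : Prop :=
  exists2 E, e E & points_converge_chain x E.

Definition chains_converge (E : nat -> nat -> set X) F : Prop :=
  forall k, exists N, forall n, (N <= n)%N -> exists l, E n l `<=` F k.

Definition ends_converge (e_ : nat -> domain_end) e : Prop :=
  exists E : nat -> nat -> set X, exists F,
    [/\ forall n, e_ n (E n), e F & chains_converge E F].

Definition mazurkiewicz_dist (x y : X) : \bar R :=
  ereal_inf [set diam A | A in
    [set A | [/\ A `<=` Omega, connected A, A x & A y]]].

Lemma divides_trans E F G : divides E F -> divides F G -> divides E G.
Proof.
move=> EF FG k; have [l lk] := FG k; have [m ml] := EF l.
by exists m; exact: subset_trans ml lk.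
Qed.

Lemma end_equiv e E F : e E -> e F -> chain_equiv E F.
Proof.
have [G _ eG] := end_chainsP e; rewrite !eG => -[_ [GE EG]] [_ [GF FG]].
by split; [exact: divides_trans EG GF|exact: divides_trans FG GE].
Qed.

Lemma end_of_chain E : chain E -> exists e, e E.
Proof.
move=> cE.
have H : exists2 E', chain E' & [set F | chain F /\ chain_equiv E F] =
    [set F | chain F /\ chain_equiv E' F] by exists E.
by exists (DomainEnd H); split=> //; split=> k; exists k.
Qed.

Lemma divides_impression E F :
  divides E F -> chain_impression E `<=` chain_impression F.
Proof.
by move=> EF x xE k _; have [l lk] := EF k; apply: closureS lk _ (xE l I).
Qed.

Lemma singleton_endP e E : e E ->
  singleton_end e <-> exists x, chain_impression E = [set x].
Proof.
move=> eE; split=> [[F eF [x xF]]|xE]; last by exists E.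
exists x; rewrite -xF; have [EF FE] := end_equiv eE eF.
by apply/seteqP; split; exact: divides_impression.
Qed.

Lemma points_convergeP x e E : e E ->
  points_converge x e <-> points_converge_chain x E.
Proof.
move=> eE; split=> [[F eF xF] k|xE]; last by exists E.
have [_ /(_ k)[l lk]] := end_equiv eE eF.
by have [N xN] := xF l; exists N => n Nn; apply: lk; exact: xN.
Qed.

Lemma ends_convergeP (e_ : nat -> domain_end) e (E : nat -> nat -> set X) F :
  (forall n, e_ n (E n)) -> e F ->
  ends_converge e_ e <-> chains_converge E F.
Proof.
move=> eE eF; split=> [[E' [F' [eE' eF' EF']]] k|EF]; last by exists E, F.
have [_ /(_ k)[l lk]] := end_equiv eF eF'.
have [N EN] := EF' l; exists N => n /EN[m ml].
have [/(_ m)[j jm] _] := end_equiv (eE n) (eE' n).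
by exists j; apply: subset_trans jm _; exact: subset_trans ml lk.
Qed.

End Ends.

(* Main.v *)
(** A doubling measure makes the complete space X proper: an e-separated subset
of a ball B has boundedly many points, because the balls of radius e/2 around
them are disjoint and each carries a fixed fraction of the measure of an
enlargement of B.  Hence the sets of a chain with singleton impression shrink
to diameter 0, and as they are connected their diameters bound the Mazurkiewicz
distance; this gives (a) => (b).

Conversely, choose points in the sets of the chains.  Since d <= d_M, comparing
two point sequences of the limit end through a common third one shows that the
limit chain F has diameters tending to 0, so its impression is a singleton.  A
connected subset of Omega joining F_(k+1) to the complement of F_k meets both
relative boundaries, so its diameter is at least their positive distance.  If
the ends did not converge, some points outside F_k would thus stay at a fixed
Mazurkiewicz distance from all points of F_(k+1). *)

Require Import Defs.
From mathcomp Require Import all_boot all_order all_algebra.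
From mathcomp Require Import all_classical all_reals all_analysis.
From mathcomp Require Import measurable_realfun.
From mathcomp Require Import ring lra.

Set Implicit Arguments.
Unset Strict Implicit.
Unset Printing Implicit Defensive.

Import Order.TTheory GRing.Theory Num.Theory.
Import numFieldNormedType.Exports.

Local Open Scope classical_set_scope.
Local Open Scope ring_scope.

(** * Ultrafilters and upper limits *)

Lemma ultra_bigcup_seq (T U : Type) (F : set_system T) (s : seq U)
    (A : U -> set T) : UltraFilter F ->
  F (\big[setU/set0]_(y <- s) A y) -> exists y, F (A y).
Proof.
move=> FU; elim: s => [|y s IHs].
  by rewrite big_nil => /filter_not_empty.
rewrite big_cons => FA.
have [Fy|FCy] := in_ultra_setVsetC (A y) FU; first by exists y.
by apply: IHs; apply: filterS (filterI FCy FA) => z [nAz [/nAz|]].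
Qed.

Lemma limn_esup_le_near {R : realType} (u : nat -> \bar R) (e : \bar R) :
  (\forall i \near \oo, u i <= e)%E -> (limn_esup u <= e)%E.
Proof.
move=> ue; apply: (@le_trans _ _ (ereal_sup (u @` [set i | (u i <= e)%E]))).
  by apply: ereal_inf_lbound; exists [set i | (u i <= e)%E].
by apply: ge_ereal_sup => _ [i ui <-].
Qed.

Lemma limn_esup_lt_near {R : realType} (u : nat -> \bar R) (e : \bar R) :
  (limn_esup u < e)%E -> (\forall i \near \oo, u i < e)%E.
Proof.
move=> /ereal_inf_lt[_ [V Voo <-]] supe; apply: filterS Voo => i Vi.
by apply: le_lt_trans supe; apply: ereal_sup_ubound; exists i.
Qed.

Lemma limn_esup_ge0 {R : realType} (u : nat -> \bar R) :
  (forall i, 0 <= u i)%E -> (0 <= limn_esup u)%E.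
Proof.
move=> u0; rewrite leNgt; apply/negP => /limn_esup_lt_near/filter_ex[i].
by rewrite ltNge u0.
Qed.

(** Unwinds the iterated limit of (b) into nested eventual bounds, which can be intersected as
    filters. Nonnegativity makes an upper limit finite as soon as it is bounded above by a real. *)
Lemma cvg_limn_esup0P {R : realType} (u : nat -> nat -> \bar R) :
  (forall n i, 0 <= u n i)%E ->
  (fun n => limn_esup (u n)) @ \oo --> 0%E <->
  (forall e : R, 0 < e -> \forall n \near \oo, \forall i \near \oo,
    (u n i < e%:E)%E).
Proof.
move=> u0; split=> [/fine_cvgP[ufin /cvgr_dist_lt u_0] e e0|ue].
  near=> n; apply: limn_esup_lt_near.
  rewrite -[X in (X < _)%E]fineK; last by near: n.
  rewrite lte_fin (le_lt_trans (ler_norm _))// -normrN -[X in `|X|]add0r.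
  by near: n; exact: u_0.
have ule (e : R) : 0 < e -> \forall n \near \oo, (limn_esup (u n) <= e%:E)%E.
  move=> /ue; apply: filterS => n une; apply: limn_esup_le_near.
  by apply: filterS une => i /ltW.
have sup0 n := limn_esup_ge0 (u0 n).
apply/fine_cvgP; split.
  apply: filterS (ule 1 ltr01) => n un1.
  by rewrite ge0_fin_numE//; exact: le_lt_trans un1 (ltry _).
apply/cvgrPdist_le => e /ule; apply: filterS => n une.
rewrite sub0r normrN ger0_norm /=; last exact: fine_ge0.
by rewrite -lee_fin fineK// ge0_fin_numE//; exact: le_lt_trans une (ltry _).
Unshelve. all: by end_near. Qed.

(** * Properness of a complete space with a doubling measure *)

Section ProperFromDoubling.
Context {R : realType} {X : completeMetricType R}.
Variable mu : {measure set (borelType X) -> \bar R}.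
Hypothesis mu_ball : forall (x : X) (r : R), 0 < r ->
  (0 < mu (ball x r))%E /\ (mu (ball x r) < +oo)%E.
Hypothesis mu_doubling : doubling mu.

Lemma metric_ball_open (x : X) (r : R) : open (ball x r).
Proof.
rewrite openE => y; rewrite ballEmdist /= => xyr; apply/nbhs_ballP.
exists (r - mdist x y) => /=; first by rewrite subr_gt0.
move=> z; rewrite !ballEmdist /= ltrBrDl; apply: le_lt_trans.
exact: metric_triangle.
Qed.

Lemma measurable_metric_ball (x : X) (r : R) :
  measurable (ball x r : set (borelType X)).
Proof. by apply: sub_sigma_algebra; exact: metric_ball_open. Qed.

Lemma doubling_iter : exists2 C : R, 0 < C & forall m (x : X) (r : R), 0 < r ->
  (mu (ball x (2 ^+ m * r)%R) <= (C ^+ m)%:E * mu (ball x r))%E.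
Proof.
have [C C0 mu2] := mu_doubling; exists C => //; elim=> [|m IHm] x r r0.
  by rewrite !expr0 mul1r mul1e.
rewrite exprSr -mulrA (le_trans (IHm _ _ _)) ?mulr_gt0//.
rewrite exprSr EFinM -muleA lee_wpmul2l ?mu2//.
by rewrite lee_fin exprn_ge0// ltW.
Qed.

(** By the triangle inequality, balls of radius [e / 2] about [e]-separated points are disjoint, so
    their measures add up. *)
Lemma measure_separated_balls (s : seq X) (e c : R) : 0 <= c ->
  (forall x, x \in s -> c%:E <= mu (ball x (e / 2)%R))%E ->
  pairwise (fun x y => e <= mdist x y) s ->
  (((size s)%:R * c)%:E <= mu (\big[setU/set0]_(x <- s) ball x (e / 2)%R))%E.
Proof.
have mU t : measurable
    (\big[setU/set0]_(x <- t) ball x (e / 2) : set (borelType X)).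
  by apply: bigsetU_measurable => x _; exact: measurable_metric_ball.
move=> c0; elim: s => [|x s IHs] cs; first by rewrite mul0r measure_ge0.
rewrite pairwise_cons => /andP[/allP xs ss].
rewrite big_cons measureU//; last 2 first.
- exact: measurable_metric_ball.
- rewrite -subset0 => z [xz].
  rewrite -bigcup_seq => -[y ys yz].
  have := xs _ ys; rewrite leNgt => /negP; apply.
  move: xz yz; rewrite !ballEmdist /= => xz yz.
  rewrite (le_lt_trans (metric_triangle x z y))// [ltRHS]splitr ltrD//.
  by rewrite metric_sym.
rewrite /= -natr1 mulrDl mul1r addrC EFinD leeD// ?cs ?mem_head//.
by apply: IHs => // y ys; rewrite cs// inE ys orbT.
Qed.

Lemma totally_bounded_ball (x0 : X) (r e : R) : 0 < r -> 0 < e ->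
  exists s : seq X, ball x0 r `<=` \big[setU/set0]_(y <- s) ball y e.
Proof.
move=> r0 e0; have [C C0 muC] := doubling_iter.
pose P n := exists s : seq X, [/\ size s = n, forall x, x \in s -> ball x0 r x &
  pairwise (fun x y => e <= mdist x y) s].
(* A separated family of maximal size: if there were none, every size would occur, and the total
   measure would exceed that of [ball x0 (r + e)]. *)
have [n Pn nPS] : exists2 n, P n & ~ P n.+1.
  apply: contrapT => PS; have {PS} PP n : P n.
    elim: n => [|n Pn]; first by exists [::]; split.
    by apply: contrapT => nPS; apply: PS; exists n.
  pose M := fine (mu (ball x0 (r + e))).
  have re0 : 0 < r + e by rewrite addr_gt0.
  have MfE : (mu (ball x0 (r + e)%R) = M%:E).
    by rewrite /M fineK// ge0_fin_numE ?measure_ge0//; case: (mu_ball x0 re0).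
  have M0 : 0 < M by rewrite -lte_fin -MfE; case: (mu_ball x0 re0).
  (* With this [m], the ball of radius [2 ^+ m * (e / 2)] about any point of [ball x0 r] contains
     [ball x0 (r + e)]; doubling then gives each ball of radius [e / 2] measure at least
     [M / C ^+ m]. *)
  have [m hm] : exists m, 2 * r + e <= 2 ^+ m * (e / 2).
    exists (Num.bound ((2 * r + e) / (e / 2))).
    rewrite -ler_pdivrMr ?divr_gt0//.
    rewrite ltW// (lt_le_trans (archi_boundP _))//.
      by rewrite divr_ge0 ?addr_ge0 ?mulr_ge0 ?divr_ge0 ?ltW.
    by rewrite -natrX ler_nat ltnW// ltn_expl.
  (* More than [C ^+ m] points, hence total measure above [M]. *)
  have [s [sn sr ss]] := PP (Num.bound (C ^+ m)).
  pose c := M / C ^+ m.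
  have Cm0 : 0 < C ^+ m by rewrite exprn_gt0.
  have mur x : x \in s -> (c%:E <= mu (ball x (e / 2)%R))%E.
    move=> /sr; rewrite ballEmdist /= => x0x.
    rewrite /c mulrC EFinM lee_pdivrMl// -MfE.
    apply: le_trans (muC m x (e / 2) _); last by rewrite divr_gt0.
    apply: le_measure; rewrite ?inE; try exact: measurable_metric_ball.
    move=> y; rewrite !ballEmdist /= => x0y.
    rewrite (lt_le_trans _ hm)// (le_lt_trans (metric_triangle x x0 y))//.
    by rewrite metric_sym mulrDl mul1r -addrA ltrD.
  have := measure_separated_balls (ltW (divr_gt0 M0 Cm0)) mur ss.
  apply/negP; rewrite -ltNge.
  apply: (@le_lt_trans _ _ M%:E).
    rewrite -MfE; apply: le_measure; rewrite ?inE.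
    - by apply: bigsetU_measurable => x _; exact: measurable_metric_ball.
    - exact: measurable_metric_ball.
    - rewrite -bigcup_seq => y [x /= /sr].
      rewrite !ballEmdist /= => x0x xy.
      rewrite (le_lt_trans (metric_triangle x0 x y))// ltrD//.
      by rewrite (lt_trans xy)// ltr_pdivrMr// ltr_pMr// ltr1n.
  rewrite lte_fin sn /c mulrA ltr_pdivlMr// mulrC ltr_pM2r//.
  by apply: archi_boundP; exact: ltW.
(* A point left uncovered could be added to the maximal family. *)
have [s [sn sr ss]] := Pn; exists s => x xr; rewrite -bigcup_seq.
apply: contrapT => xs; apply: nPS; exists (x :: s); split.
- by rewrite /= sn.
- by move=> y; rewrite inE => /orP[/eqP->|/sr].
- rewrite pairwise_cons ss andbT; apply/allP => y ys.
  rewrite leNgt; apply/negP => xy; apply: xs; exists y => //.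
  by rewrite ballEmdist /= metric_sym.
Qed.

(** An ultrafilter on [A] contains one of finitely many covering balls of each radius, so it is
    Cauchy and converges by completeness. *)
Lemma compact_closed_bounded (A : set X) (x0 : X) (r : R) : 0 < r ->
  closed A -> A `<=` ball x0 r -> compact A.
Proof.
move=> r0 Acl Ar; rewrite compact_ultra => F FU FA.
have /cauchy_cvg Fcvg : cauchy F.
  apply: cauchy_exP => e e0.
  have [s s_cover] := totally_bounded_ball x0 r0 e0.
  by apply: (@ultra_bigcup_seq _ _ _ s); apply: filterS FA => x /Ar/s_cover.
exists (lim F); split => //.
by apply: (closed_cvg _ Acl) Fcvg; exact: FA.
Qed.

End ProperFromDoubling.

(** * The Mazurkiewicz distance and crossing of boundaries *)

Section MazurkiewiczDistance.
Context {R : realType} {X : metricType R}.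
Implicit Types (A C Omega : set X) (x y : X).

Lemma mdist_le_diam A x y : A x -> A y -> ((mdist x y)%:E <= diam A)%E.
Proof. by move=> Ax Ay; apply: ereal_sup_ubound; exists x => //; exists y. Qed.

Lemma mdist_le_mazurkiewicz_dist Omega x y :
  ((mdist x y)%:E <= mazurkiewicz_dist Omega x y)%E.
Proof.
by apply: le_ereal_inf_tmp => _ [A [_ _ Ax Ay] <-]; exact: mdist_le_diam.
Qed.

Lemma mazurkiewicz_distC Omega x y :
  mazurkiewicz_dist Omega x y = mazurkiewicz_dist Omega y x.
Proof.
by congr ereal_inf; apply/seteqP; split=> _ [A [AO Ac Ax Ay] <-]; exists A.
Qed.

Lemma mazurkiewicz_dist_ge0 Omega x y : (0 <= mazurkiewicz_dist Omega x y)%E.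
Proof.
apply: le_trans (mdist_le_mazurkiewicz_dist _ _ _).
by rewrite lee_fin mdist_ge0.
Qed.

Lemma mazurkiewicz_dist_le_diam Omega A x y : A `<=` Omega -> connected A ->
  A x -> A y -> (mazurkiewicz_dist Omega x y <= diam A)%E.
Proof. by move=> AO Ac Ax Ay; apply: ereal_inf_lbound; exists A. Qed.

(** If [C] missed the boundary, its parts in the interior and in the closure of [A] would coincide;
    this part is clopen in [C] and contains [x], so it would be all of [C], including [y]. *)
Lemma connected_meets_boundary C A x y : connected C -> C x -> A x ->
  C y -> ~ A y -> C `&` boundary A !=set0.
Proof.
move=> Cc Cx Ax Cy nAy; apply: contrapT => CA0.
have CA z : C z -> closure A z -> A° z.
  by move=> Cz Az; apply: contrapT => nAz; apply: CA0; exists z.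
have CAE : C `&` A° = C `&` closure A.
  apply/seteqP; split=> z [Cz Az]; split => //; last exact: CA.
  by apply: subset_closure; exact: interior_subset.
have : C `&` A° = C.
  apply: Cc.
  - by exists x; split => //; apply: CA => //; exact: subset_closure.
  - by exists A° => //; exact: open_interior.
  - by exists (closure A); [exact: closed_closure|].
by move/seteqP => [_ /(_ y Cy)[_ /interior_subset]].
Qed.

Lemma set_dist_boundary_le_mazurkiewicz_dist Omega A A' x y :
  A' `<=` A -> A' x -> ~ A y ->
  (set_dist (Omega `&` boundary A') (Omega `&` boundary A) <=
    mazurkiewicz_dist Omega x y)%E.
Proof.
move=> A'A A'x nAy; apply: le_ereal_inf_tmp => _ [C [CO Cc Cx Cy] <-].
have nA'y : ~ A' y by move/A'A.
have [u [Cu A'u]] := connected_meets_boundary Cc Cx A'x Cy nA'y.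
have [v [Cv Av]] := connected_meets_boundary Cc Cx (A'A _ A'x) Cy nAy.
apply: le_trans (mdist_le_diam Cu Cv).
apply: ereal_inf_lbound; exists u; first by split => //; exact: CO.
by exists v => //; split => //; exact: CO.
Qed.

End MazurkiewiczDistance.

(** * Points of chains *)

Section Chains.
Context {R : realType} {X : metricType R}.
Variable Omega : set X.
Implicit Types (E F : nat -> set X) (e : domain_end Omega).

Lemma end_chain e E : e E -> chain Omega E.
Proof. by have [G _ ->] := end_chainsP e => -[]. Qed.

Lemma end_representative e : exists E, e E.
Proof.
have [G cG ->] := end_chainsP e; exists G.
by split=> //; split=> k; exists k.
Qed.

Lemma chain_subset E : chain Omega E ->
  {homo E : k l / (k <= l)%N >-> l `<=` k}.
Proof.
move=> [_ ES _ _]; apply: homo_leq => [A|A B C AB BC|//].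
  exact: subset_refl.
exact: subset_trans BC AB.
Qed.

(** Nonemptiness is implicit in acceptability: the closure meets the boundary of [Omega], and an
    empty set has empty closure. *)
Lemma chain_nonempty E k : chain Omega E -> E k !=set0.
Proof.
move=> [/(_ k)[_ _ _ [x [Ex _]]] _ _ _].
by have [y [Ey _]] := Ex _ (filterT : nbhs x setT); exists y.
Qed.

Lemma chain_subset_domain E k : chain Omega E -> E k `<=` Omega.
Proof. by move=> [/(_ k)[_ _ []]]. Qed.

Lemma chain_points_converge E (x : nat -> X) : chain Omega E ->
  (forall i, E i (x i)) -> points_converge_chain x E.
Proof.
by move=> cE Ex k; exists k => i ki; exact: chain_subset cE _ _ ki _ (Ex i).
Qed.

(** Serves both implications: it turns diameters that do not tend to 0 into sequences of points. *)
Lemma far_point_sequences E (e : R) :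
  ~ (exists k, forall x y, E k x -> E k y -> mdist x y < e) ->
  exists y z : nat -> X, [/\ forall k, E k (y k), forall k, E k (z k) &
    forall k, e <= mdist (y k) (z k)].
Proof.
move=> nE.
have far k : exists yz, [/\ E k yz.1, E k yz.2 & e <= mdist yz.1 yz.2].
  apply: contrapT => nyz; apply: nE; exists k => y z Ey Ez.
  by rewrite ltNge; apply/negP => eyz; apply: nyz; exists (y, z).
have {far}[yz yzP] := choice far.
by exists (fst \o yz), (snd \o yz); split=> k; case: (yzP k).
Qed.

End Chains.

(** * Chains in a proper space *)

Section CompactChains.
Context {R : realType} {X : metricType R}.
Variable Omega : set X.
Hypothesis compact_bounded : forall (A : set X) (x0 : X) (r : R), 0 < r ->
  closed A -> A `<=` ball x0 r -> compact A.
Implicit Types (E : nat -> set X).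

(** The sequence clusters in the compact closure of [E 0]; as it eventually stays in each [E k], the
    cluster point lies in every closure. *)
Lemma chain_cluster E (w : nat -> X) : chain Omega E ->
  (forall k, E k (w k)) -> exists2 x, chain_impression E x &
    forall e : R, 0 < e -> forall N, exists2 n, (N <= n)%N & mdist x (w n) < e.
Proof.
move=> cE Ew; have [Eacc _ _ _] := cE.
have wE k : (w @ \oo) (E k).
  by exists k => // n kn; exact: chain_subset cE _ _ kn _ (Ew n).
have clE0 : compact (closure (E 0)).
  have [E0fin _ _ _] := Eacc 0%N.
  have d0 : (0 <= diam (E 0%N))%E.
    apply: le_trans (mdist_le_diam (Ew 0%N) (Ew 0%N)).
    by rewrite lee_fin mdist_ge0.
  pose d := fine (diam (E 0%N)).
  have dE : diam (E 0%N) = d%:E by rewrite /d fineK// ge0_fin_numE.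
  (* Points of the closure lie within 1 of [E 0], hence at distance less than [d + 1] from [w 0]. *)
  apply: (@compact_bounded _ (w 0%N) (d + 2)).
  - by rewrite ltr_wpDl// fine_ge0.
  - exact: closed_closure.
  - move=> y /(_ _ (nbhsx_ballx y 1 ltr01))[z [Ez]].
    rewrite !ballEmdist /= metric_sym => zy.
    rewrite (le_lt_trans (metric_triangle _ z _))//.
    rewrite ler_ltD ?(lt_trans zy) ?ltr1n//.
    by rewrite -lee_fin -dE; exact: mdist_le_diam.
have [x [_ wx]] := clE0 _ _ (filterS (@subset_closure _ _) (wE 0%N)).
exists x; first by move=> k _; move: wx; rewrite clusterE; apply; exact: wE.
move=> e e0 N.
have [||_ [[n Nn <-]]] := wx (w @` [set n | (N <= n)%N]) (ball x e).
- by exists N => // n Nn; exists n.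
- exact: nbhsx_ballx.
- by rewrite ballEmdist => xn; exists n.
Qed.

Lemma chain_diam_lt E : chain Omega E -> is_subset1 (chain_impression E) ->
  forall e : R, 0 < e ->
    exists k, forall x y, E k x -> E k y -> mdist x y < e.
Proof.
move=> cE Esub e e0; apply: contrapT.
move=> /far_point_sequences[u [v [Eu Ev euv]]].
have [x xE _] := chain_cluster cE Eu.
(* One point of each far pair stays away from the cluster point [x]; these points cluster at a
   second point of the impression. *)
have farx k : exists z, E k z /\ e / 2 <= mdist x z.
  have [lex|ltx] := leP (e / 2) (mdist x (u k)); first by exists (u k).
  exists (v k); split => //; rewrite leNgt; apply/negP => lty.
  have := euv k; apply/negP; rewrite -ltNge.
  rewrite (le_lt_trans (metric_triangle _ x _))//.
  by rewrite metric_sym [ltRHS]splitr ltrD.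
have {farx}[z zP] := choice farx.
have [y yE zy] := chain_cluster cE (fun k => (zP k).1).
have e20 : 0 < e / 2 by rewrite divr_gt0.
have [n _] := zy _ e20 0%N.
by rewrite (Esub _ _ yE xE) ltNge (zP n).2.
Qed.

End CompactChains.

(** * The two implications for fixed representative chains *)

Section EndConvergence.
Context {R : realType} {X : metricType R}.
Variable Omega : set X.
Hypothesis compact_bounded : forall (A : set X) (x0 : X) (r : R), 0 < r ->
  closed A -> A `<=` ball x0 r -> compact A.
Variables (E : nat -> nat -> set X) (F : nat -> set X).
Hypotheses (cE : forall n, chain Omega (E n)) (cF : chain Omega F).

(** Condition (b) for fixed representatives, in epsilon form. *)
Definition mazurkiewicz_close : Prop :=
  forall (x_ : nat -> nat -> X) (x : nat -> X),
    (forall n i, Omega (x_ n i)) -> (forall i, Omega (x i)) ->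
    (forall n, points_converge_chain (x_ n) (E n)) ->
    points_converge_chain x F ->
    forall e : R, 0 < e -> \forall n \near \oo, \forall i \near \oo,
      (mazurkiewicz_dist Omega (x_ n i) (x i) < e%:E)%E.

Lemma chains_converge_mazurkiewicz_close :
  chains_converge E F -> is_subset1 (chain_impression F) -> mazurkiewicz_close.
Proof.
move=> EF F1 x_ x _ _ x_E xF e e0.
(* Half of [e], since the supremum defining the diameter only keeps a weak inequality. *)
have e20 : 0 < e / 2 by rewrite divr_gt0.
have [k Fk] := chain_diam_lt compact_bounded cF F1 e20.
have [N EFk] := EF k; exists N => // n /EFk[l Elk].
have [I xI] := x_E n l; have [J xJ] := xF k.
exists (maxn I J) => // i /=; rewrite geq_max => /andP[Ii Ji].
have [/(_ k)[_ Fkc _ _] _ _ _] := cF.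
apply: le_lt_trans (mazurkiewicz_dist_le_diam (chain_subset_domain cF) Fkc
  (Elk _ (xI _ Ii)) (xJ _ Ji)) _.
apply: (@le_lt_trans _ _ (e / 2)%:E); last first.
  by rewrite lte_fin ltr_pdivrMr// ltr_pMr// ltr1n.
by apply: ge_ereal_sup => _ [y Fy [z Fz <-]]; rewrite lee_fin ltW// Fk.
Qed.

Lemma mazurkiewicz_close_chain_points (x_ : nat -> nat -> X) (x : nat -> X) :
  mazurkiewicz_close ->
  (forall n i, E n i (x_ n i)) -> (forall i, F i (x i)) ->
  forall e : R, 0 < e -> \forall n \near \oo, \forall i \near \oo,
    (mazurkiewicz_dist Omega (x_ n i) (x i) < e%:E)%E.
Proof.
move=> close x_E xF; apply: close.
- by move=> n i; exact: chain_subset_domain (cE n) _ (x_E n i).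
- by move=> i; exact: chain_subset_domain cF _ (xF i).
- by move=> n; exact: chain_points_converge (cE n) (x_E n).
- exact: chain_points_converge cF xF.
Qed.

Lemma mazurkiewicz_close_singleton :
  mazurkiewicz_close -> exists x, chain_impression F = [set x].
Proof.
move=> close.
have xE n i : exists x, E n i x := chain_nonempty i (cE n).
pose x_ n := projT1 (choice (xE n)); have x_E n := projT2 (choice (xE n)).
have Fdiam (e : R) : 0 < e ->
    exists k, forall y z, F k y -> F k z -> mdist y z < e.
  move=> e0; apply: contrapT => /far_point_sequences[y [z [yF zF eyz]]].
  have e20 : 0 < e / 2 by rewrite divr_gt0.
  (* [x_ n i] is the common third point, close to both [y i] and [z i]. *)
  have [n [yn zn]] :=
    filter_ex (filterI (mazurkiewicz_close_chain_points close x_E yF e20)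
      (mazurkiewicz_close_chain_points close x_E zF e20)).
  have [i [yi zi]] := filter_ex (filterI yn zn).
  have := eyz i; apply/negP; rewrite -ltNge.
  rewrite (le_lt_trans (metric_triangle _ (x_ n i) _))// [ltRHS]splitr ltrD//.
    rewrite metric_sym -lte_fin.
    exact: le_lt_trans (mdist_le_mazurkiewicz_dist _ _ _) yi.
  by rewrite -lte_fin; exact: le_lt_trans (mdist_le_mazurkiewicz_dist _ _ _) zi.
have [y yF] := choice (fun k => chain_nonempty k cF).
have [x xF _] := chain_cluster compact_bounded cF yF.
exists x; apply/seteqP; split=> [z zF|_ ->//].
apply: mdist_positivity; apply/eqP; rewrite eq_le mdist_ge0 andbT.
apply/ler_addgt0Pl => e e0; rewrite addr0.
(* One third for each of the steps from [z] to [u], [u] to [v] and [v] to [x], with [u] and [v] in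
   [F k]. *)
have e30 : 0 < e / 3 by rewrite divr_gt0.
have [k Fk] := Fdiam _ e30.
have [u [Fu zu]] := zF k I _ (nbhsx_ballx z _ e30).
have [v [Fv xv]] := xF k I _ (nbhsx_ballx x _ e30).
have uv := Fk _ _ Fu Fv; move: zu xv; rewrite !ballEmdist /= => zu xv.
have zuv := metric_triangle z u x; have uvx := metric_triangle u v x.
rewrite (metric_sym v x) in uvx.
have : e = e / 3 + e / 3 + e / 3 by field.
lra.
Qed.

Lemma mazurkiewicz_close_chains_converge :
  mazurkiewicz_close -> chains_converge E F.
Proof.
move=> close k; apply: contrapT => nEF.
(* Points are taken outside [F k] whenever possible. *)
have xE n i : exists x, E n i x /\ (~ (E n i `<=` F k) -> ~ F k x).
  have [EF|] := pselect (E n i `<=` F k).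
    by have [x Ex] := chain_nonempty i (cE n); exists x.
  by move=> /existsNP[x /not_implyP[Ex nFx]]; exists x.
pose x_ n := projT1 (choice (xE n)); have x_E n := projT2 (choice (xE n)).
have x_En n i := (x_E n i).1.
have [y yF] := choice (fun k => chain_nonempty k cF).
have [_ FS /(_ k) Fdist _] := cF.
(* The distance is [+oo] if a relative boundary is empty; then 1 serves as lower bound. *)
have [e e0 eF] : exists2 e : R, 0 < e &
    (e%:E <=
      set_dist (Omega `&` boundary (F k.+1)) (Omega `&` boundary (F k)))%E.
  move: Fdist; case: set_dist => [d d0||//]; first by exists d.
  by exists 1; rewrite ?leey.
have [N _ closeN] := mazurkiewicz_close_chain_points close x_En yF e0.
apply: nEF; exists N => n /closeN[I _ closeI]; apply: contrapT => nEF.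
(* At least [k.+1], so that [y i] lies in [F k.+1]. *)
pose i := maxn I k.+1.
have := closeI i (leq_maxl _ _); apply/negP; rewrite -leNgt.
apply: le_trans eF _.
rewrite mazurkiewicz_distC.
apply: set_dist_boundary_le_mazurkiewicz_dist; first exact: FS.
- by apply: chain_subset cF _ _ _ _ (yF i); exact: leq_maxr.
- by apply: (x_E n i).2 => EFi; apply: nEF; exists i.
Qed.

End EndConvergence.

Theorem lemma8p11 (R : realType) (X : completeMetricType R)
  (mu : {measure set (borelType X) -> \bar R}) (p : R) (Omega : set X)
  (hX : exists x y : X, x <> y)
  (hmu : forall (x : X) (r : R), 0 < r ->
    (0 < mu (ball x r))%E /\ (mu (ball x r) < +oo)%E)
  (hp : 1 <= p)
  (hdoubling : doubling mu)
  (hpoincare : poincare mu p)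
  (hOmega : bounded_domain Omega)
  (hOmegaT : Omega `<` setT)
  (e_ : nat -> domain_end Omega) (e_infty : domain_end Omega) :
  (ends_converge e_ e_infty /\ singleton_end e_infty) <->
  (forall (x_ : nat -> nat -> X) (x_infty : nat -> X),
    (forall n i, Omega (x_ n i)) -> (forall i, Omega (x_infty i)) ->
    (forall n, points_converge (x_ n) (e_ n)) ->
    points_converge x_infty e_infty ->
    (fun n => limn_esup (fun i =>
      mazurkiewicz_dist Omega (x_ n i) (x_infty i))) @ \oo --> 0%E).
Proof.
have XK := compact_closed_bounded hmu hdoubling.
have [E eE] := choice (fun n => end_representative (e_ n)).
have [F eF] := end_representative e_infty.
have cE n := end_chain (eE n); have cF := end_chain eF.
have dM0 x_ x n i := mazurkiewicz_dist_ge0 Omega (x_ n i : X) (x i).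
(* Both parts of (a) may be tested on the chosen representatives. *)
rewrite (ends_convergeP eE eF) (singleton_endP eF); split.
  move=> [EF [z Fz]] x_ x x_O xO x_E xF; apply/cvg_limn_esup0P => //.
  apply: (chains_converge_mazurkiewicz_close XK cF EF) => //.
  - by rewrite Fz => u v -> ->.
  - by move=> n; exact/(points_convergeP _ (eE n)).
  - exact/(points_convergeP _ eF).
move=> dM_0.
have close : mazurkiewicz_close Omega E F.
  move=> x_ x x_O xO x_E xF; apply/cvg_limn_esup0P => //; apply: dM_0 => //.
  - by move=> n; exact/(points_convergeP _ (eE n)).
  - exact/(points_convergeP _ eF).
split; first exact: (mazurkiewicz_close_chains_converge cE cF close).
exact: (mazurkiewicz_close_singleton XK cE cF close).
Qed.
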